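(* Consider the conditional heteroscedastic linear regression model $Y_i=\boldsymbol x_i^T\boldsymbol\beta+\epsilon_i$, $i=1,2,\dots$, with independent $\epsilon_i\sim\mathcal N(0,\sigma^2h(\boldsymbol z_i^T\boldsymbol\alpha))$ and parameter $\boldsymbol\theta=(\boldsymbol\alpha^T,\sigma^2,\boldsymbol\beta^T)^T$, and the test of homoscedasticity $H_0:\boldsymbol\alpha=\boldsymbol0_r$ versus $H_1:\boldsymbol\alpha\ne\boldsymbol0_r$. For every tuning parameter $\beta>0$, every null value $\boldsymbol\theta_0=(\boldsymbol0_r^T,\sigma_0^2,\boldsymbol\beta_0^T)^T$ and every $\boldsymbol\delta\in\mathbb R^r\setminus\{\boldsymbol0_r\}$, the Pitman asymptotic relative efficiency of the Breusch-Pagan $\beta$-score LM test-statistic with respect to the classical one ($\beta=0$), namely $\mathrm{ARE}=\nu_{0}(\boldsymbol\theta_0,\boldsymbol\delta)/\nu_\beta(\boldsymbol\theta_0,\boldsymbol\delta)$, is given by $$\mathrm{ARE}=\frac{8(\beta+1)^5}{(\beta^2+2)^2}\left(\frac{2\beta^2+1}{2(2\beta+1)^{5/2}}-\frac{\beta^2}{4(\beta+1)^3}\right).$$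
   Context: The scalar $\beta$ is a tuning parameter; the boldface $\boldsymbol\beta\in\mathbb R^{p+1}$ is the vector of regression coefficients (unrelated). The vectors $\boldsymbol x_i=(1,x_{i1},\dots,x_{ip})^T\in\mathbb R^{p+1}$ and $\boldsymbol z_i\in\mathbb R^r$ are fixed (non-random), $\boldsymbol\alpha\in\mathbb R^r$, $\sigma^2>0$. The scedastic function $h:\mathbb R\to\mathbb R$ is continuous, possesses first and second derivatives, and satisfies $h(\eta)>0$ for all $\eta$, $h(0)=1$, $h'(0)\ne0$. Let $f_{i,\boldsymbol\theta}$ be the density of $\mathcal N(\boldsymbol x_i^T\boldsymbol\beta,\sigma^2h(\boldsymbol z_i^T\boldsymbol\alpha))$ and $\boldsymbol s_{i,\boldsymbol\theta}(y)=\frac{\partial}{\partial\boldsymbol\theta}\log f_{i,\boldsymbol\theta}(y)$. For $\beta\ge0$ put $$\boldsymbol J_{i,\beta}(\boldsymbol\theta)=\int f_{i,\boldsymbol\theta}^{\beta+1}\boldsymbol s_{i,\boldsymbol\theta}\boldsymbol s_{i,\boldsymbol\theta}^T\,dy,\quad \boldsymbol\xi_{i,\beta}(\boldsymbol\theta)=\int f_{i,\boldsymbol\theta}^{\beta+1}\boldsymbol s_{i,\boldsymbol\theta}\,dy,\quad \boldsymbol K_{i,\beta}(\boldsymbol\theta)=\boldsymbol J_{i,2\beta}(\boldsymbol\theta)-\boldsymbol\xi_{i,\beta}(\boldsymbol\theta)\boldsymbol\xi_{i,\beta}^T(\boldsymbol\theta),$$ $$\boldsymbol J_\beta(\boldsymbol\theta)=\lim_{n\to\infty}\frac1n\sum_{i=1}^n\boldsymbol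 J_{i,\beta}(\boldsymbol\theta),\qquad \boldsymbol K_\beta(\boldsymbol\theta)=\lim_{n\to\infty}\frac1n\sum_{i=1}^n\boldsymbol K_{i,\beta}(\boldsymbol\theta),\qquad \boldsymbol V_\beta(\boldsymbol\theta)=\boldsymbol J_\beta^{-1}(\boldsymbol\theta)\boldsymbol K_\beta(\boldsymbol\theta)\boldsymbol J_\beta^{-1}(\boldsymbol\theta).$$ Standing assumption: at $\boldsymbol\theta_0$ these limits exist and $\boldsymbol J_\beta(\boldsymbol\theta_0)$, $\boldsymbol K_\beta(\boldsymbol\theta_0)$ are nonsingular (equivalently, the matrices $\frac1n\sum_{i=1}^n\boldsymbol x_i\boldsymbol x_i^T$ and $\frac1n\sum_{i=1}^n\boldsymbol{\breve z}_i\boldsymbol{\breve z}_i^T$, with $\boldsymbol{\breve z}_i=(1,\boldsymbol z_i^T)^T$, converge to positive definite limits). With $\boldsymbol M=(\boldsymbol I_r,\boldsymbol0_{r\times(p+2)})^T$ (the derivative $\partial\boldsymbol m^T/\partial\boldsymbol\theta$ of $\boldsymbol m(\boldsymbol\theta)=\boldsymbol\alpha$), the asymptotic noncentrality parameter of the $\beta$-score LM test under local alternatives $\boldsymbol m(\boldsymbol\theta_n)=\boldsymbol\delta/\sqrt n$ is $$\nu_\beta(\boldsymbol\theta_0,\boldsymbol\delta)=\boldsymbol\delta^T\left[\boldsymbol M^T\boldsymbol V_\beta(\boldsymbol\theta_0)\boldsymbol M\right]^{-1}\boldsymbol\delta,$$ and the Pitman asymptotic relative efficiency is defined as the ratio $\nu_{0}(\boldsymbol\theta_0,\boldsymbol\delta)/\nu_\beta(\boldsymbol\theta_0,\boldsymbol\delta)$,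 where $\nu_0$ is $\nu_\beta$ at $\beta=0$. *)

(* Defs.v *)
From HB Require Import structures.
From mathcomp Require Import all_boot all_order all_algebra.
From mathcomp Require Import all_classical all_reals all_analysis.

Set Implicit Arguments.
Unset Strict Implicit.
Unset Printing Implicit Defensive.

Import Order.TTheory GRing.Theory Num.Theory.
Import numFieldNormedType.Exports.

Local Open Scope classical_set_scope.
Local Open Scope ring_scope.

(* The heteroscedastic linear model Y_i = x_i^T b + eps_i, with independent
   eps_i ~ N(0, sigma^2 h(z_i^T alpha)), i = 1, 2, ...; the parameter is the
   column theta = (alpha, sigma^2, b) of size r + 1 + (1 + p).  The tuning
   parameter is always called [beta], the regression coefficients [b].
   The term of index 0 of a sequence is never used. *)
Section BetaScoreLM.
Context {R : realType} {r p : nat}.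

Notation param := 'cV[R]_(r + (1 + (1 + p))).
Notation param_mx := 'M[R]_(r + (1 + (1 + p))).

Definition par_alpha (theta : param) : 'cV[R]_r := usubmx theta.
Definition par_sigma2 (theta : param) : R := usubmx (dsubmx theta) ord0 ord0.
Definition par_b (theta : param) : 'cV[R]_(1 + p) := dsubmx (dsubmx theta).

Definition mk_param (alpha : 'cV[R]_r) (sigma2 : R) (b : 'cV[R]_(1 + p))
  : param := col_mx alpha (col_mx sigma2%:M b).

Definition dotv n (u v : 'cV[R]_n) : R := (u^T *m v) ord0 ord0.

Definition add_intercept (w : 'cV[R]_p) : 'cV[R]_(1 + p) :=
  col_mx (const_mx 1) w.

(* [w i] holds the covariates (x_i1, ..., x_ip), without the intercept. *)
Variables (h : R -> R) (w : nat -> 'cV[R]_p) (z : nat -> 'cV[R]_r).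

(* [normal_pdf m s] takes the standard deviation [s], not the variance. *)
Definition density (i : nat) (theta : param) (y : R) : R :=
  normal_pdf (dotv (add_intercept (w i)) (par_b theta))
    (Num.sqrt (par_sigma2 theta * h (dotv (z i) (par_alpha theta)))) y.

Definition score (i : nat) (theta : param) (y : R) : param :=
  \col_j 'D_(delta_mx j ord0) (fun t : param => ln (density i t y)) theta.

Definition J_i (i : nat) (beta : R) (theta : param) : param_mx :=
  \matrix_(j, k) (\int[lebesgue_measure]_y
    (density i theta y `^ (beta + 1) *
     (score i theta y *m (score i theta y)^T) j k)).

Definition xi_i (i : nat) (beta : R) (theta : param) : param :=
  \col_j (\int[lebesgue_measure]_y
    (density i theta y `^ (beta + 1) * score i theta y j ord0)).

Definition K_i (i : nat) (beta : R) (theta : param) : param_mx :=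
  J_i i (2 * beta) theta - xi_i i beta theta *m (xi_i i beta theta)^T.

Definition J_avg (beta : R) (theta : param) (n : nat) : param_mx :=
  n%:R^-1 *: \sum_(1 <= i < n.+1) J_i i beta theta.

Definition K_avg (beta : R) (theta : param) (n : nat) : param_mx :=
  n%:R^-1 *: \sum_(1 <= i < n.+1) K_i i beta theta.

Definition J_mx (beta : R) (theta : param) : param_mx :=
  lim (J_avg beta theta @ \oo).

Definition K_mx (beta : R) (theta : param) : param_mx :=
  lim (K_avg beta theta @ \oo).

Definition regular_at (beta : R) (theta : param) : Prop :=
  [/\ cvg (J_avg beta theta @ \oo), cvg (K_avg beta theta @ \oo),
      J_mx beta theta \in unitmx & K_mx beta theta \in unitmx].

Definition V_mx (beta : R) (theta : param) : param_mx :=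
  invmx (J_mx beta theta) *m K_mx beta theta *m invmx (J_mx beta theta).

(* M = (I_r, 0)^T, the derivative of the restriction m(theta) = alpha. *)
Definition M_mx : 'M[R]_(r + (1 + (1 + p)), r) := (row_mx 1%:M 0)^T.

Definition noncentrality (beta : R) (theta : param) (delta : 'cV[R]_r) : R :=
  (delta^T *m invmx (M_mx^T *m V_mx beta theta *m M_mx) *m delta) ord0 ord0.

Definition pitman_ARE (beta : R) (theta : param) (delta : 'cV[R]_r) : R :=
  noncentrality 0 theta delta / noncentrality beta theta delta.

End BetaScoreLM.

(* Main.v *)
Require Import Defs.
From HB Require Import structures.
From mathcomp Require Import all_boot all_order all_algebra.
From mathcomp Require Import all_classical all_reals all_analysis.
From mathcomp Require Import measurable_realfun ring lra.

Import Order.TTheory GRing.Theory Num.Theory.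
Import numFieldNormedType.Exports.

Local Open Scope classical_set_scope.
Local Open Scope ring_scope.

(** Write the regression at the null point as y = mean_i + u with u centred
    Gaussian of variance v.  The score is there
      ((u^2/v - 1)/2) scale_dir_i + (u/v) mean_dir_i,
    where scale_dir_i lives on the coordinates (alpha, sigma^2) and mean_dir_i
    on the regression coefficients.  Raising a normal density of variance v to
    the power beta + 1 gives a constant times a normal density of variance
    v/(beta + 1), so every entry of J_i,beta, xi_i,beta and K_i,beta is a
    moment of order at most four of a Gaussian, and odd moments vanish:
      J_i,beta = J_scale(beta) scale_dir_i scale_dir_i^T
                 + J_mean(beta) mean_dir_i mean_dir_i^T,
      K_i,beta = K_scale(beta) scale_dir_i scale_dir_i^T
                 + J_mean(2 beta) mean_dir_i mean_dir_i^T,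
    with scalars independent of i ([J_i_null], [K_i_null]).

    Since scale_dir_i and mean_dir_i have disjoint supports, these matrices
    are obtained from J_i,0 by multiplying on the left by a matrix that is
    scalar on each of the two blocks and does not depend on i.  This relation
    survives averaging and passing to the limit ([J_mx_weight],
    [K_mx_weight]), so J_beta and K_beta are both block weightings of the
    single matrix J_0, and in the sandwich V_beta all the design-dependent
    parts collapse to one inverse of J_0.  On the alpha block the weights
    are scalars, whence V_beta M = lambda(beta) J_0^-1 M ([V_mx_M]) with
    lambda(beta) = K_scale(beta) J_scale(0) / J_scale(beta)^2
    ([variance_factor]).  Hence nu_beta = nu_0 / lambda(beta), because
    lambda(0) = 1.

    The quotient nu_0 / nu_beta is therefore lambda(beta), provided that
    nu_0 is nonzero and lambda(beta) is nonzero.  The former holds because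
    J_0 is a nonsingular limit of positive semidefinite matrices, hence
    positive definite ([J_mx0_posdef]), and positive definiteness is kept by
    inversion and by compression to the alpha block; the latter because
    lambda(beta) = 0 would make K_beta singular.  Inserting the moments in
    lambda(beta) gives the announced closed form ([variance_factorE]). *)

(** * Moments of the normal distribution *)

(** Exhaustion by the intervals [-(n+1), n+1]: on each of them the fundamental
    theorem of calculus applies, and dominated convergence, with |f| itself as
    dominating function, identifies the limit.  The function f may change
    sign, as the derivative of (x - m)^k times a Gaussian density does. *)
Lemma Rintegral_derive1T {R : realType} (F f : R -> R) (l1 l2 : R) :
  (forall x : R, is_derive x 1 F (f x)) -> continuous f ->
  lebesgue_measure.-integrable setT (EFin \o f) ->
  F x @[x --> -oo] --> l1 -> F x @[x --> +oo] --> l2 ->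
  \int[lebesgue_measure]_x f x = l2 - l1.
Proof.
move=> dF cf intf Fl1 Fl2.
pose A : nat -> set R := fun n => [set` `[- n.+1%:R, n.+1%:R : R]].
have contF : continuous F.
  by move=> x; apply: differentiable_continuous; apply/derivable1_diffP.
have cvg1 : (\int[lebesgue_measure]_x ((f \_ (A n)) x)%:E)%E @[n --> \oo]
    --> (\int[lebesgue_measure]_x (f x)%:E)%E.
  have mf : measurable_fun setT f by exact: continuous_measurable_fun.
  have := @dominated_cvg _ _ _ (@lebesgue_measure R) setT measurableT
      (fun n x => ((f \_ (A n)) x)%:E) (fun x => (f x)%:E) (fun x => `|f x|%:E).
  apply => //.
  - move=> n; apply/measurable_EFinP.
    apply: (measurable_restrictT f (measurable_itv _)).1.
    exact: (measurable_funS measurableT (@subsetT _ _) mf).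
  - move=> x _; apply: cvg_near_cst; near=> n.
    rewrite patchE mem_set//=; rewrite /A/= in_itv/= -ler_norml (@le_trans _ _ n%:R) ?ler_nat//.
    by near: n; exact: nbhs_infty_ger.
  - by have /integrable_abse := intf.
  - move=> n x _; rewrite patchE; case: ifP => _ /=; first by [].
    by rewrite normr0 lee_fin.
have cvg2 : (\int[lebesgue_measure]_x ((f \_ (A n)) x)%:E)%E @[n --> \oo]
    --> (l2 - l1)%:E.
  have -> : (fun n => \int[lebesgue_measure]_x ((f \_ (A n)) x)%:E)%E =
      (fun n : nat => (F n.+1%:R - F (- n.+1%:R))%:E).
    apply/funext => n.
    rewrite EFinB -(@continuous_FTC2 _ f F)//.
    - by rewrite [RHS]integral_mkcond; apply: eq_integral => x _; rewrite !patchE; case: ifP.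
    - by apply: (@lt_trans _ _ 0); rewrite ?oppr_lt0 ltr0Sn.
    - exact: continuous_subspaceT.
    - split.
      + by move=> x _; have [] := dF x.
      + exact/cvg_at_right_filter/contF.
      + exact/cvg_at_left_filter/contF.
    - by move=> x _; rewrite derive1E; apply: derive_val.
  apply: cvg_EFin; first exact: nearW.
  have S : (n.+1%:R : R) @[n --> \oo] --> +oo.
    by apply/cvgryPge => r; near=> n; rewrite (@le_trans _ _ n%:R) ?ler_nat//; near: n; exact: nbhs_infty_ger.
  apply: cvgB.
    by have /cvg_pinftyP := Fl2; apply.
  have /cvg_ninftyP := Fl1; apply.
  exact/cvgNrNy.
rewrite /Rintegral.
by have /= -> := cvg_unique _ cvg1 cvg2.
Unshelve. all: by end_near. Qed.

Section normal_moments.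
Context {R : realType} (m s : R).
Hypothesis s_gt0 : 0 < s.
Notation mu := lebesgue_measure.

Let s_neq0 : s != 0. Proof. by rewrite gt_eqF. Qed.

(** Half of the Gaussian exponent absorbs any power of x - m, and the other half
    is the exponent of a normal density with doubled variance.  This single
    bound yields integrability of all moments and decay at infinity. *)
Lemma exprn_normal_pdf_le k : exists C : R, forall x,
  `|(x - m) ^+ k * normal_pdf m s x| <= C * normal_pdf m (Num.sqrt 2 * s) x.
Proof.
have t_neq0 : Num.sqrt 2 * s != 0 by rewrite mulf_neq0// gt_eqF// sqrtr_gt0.
pose K : R := (2 * s) ^+ k * (k`!%:R * expR 1).
exists (K * (normal_peak s / normal_peak (Num.sqrt 2 * s))) => x.
rewrite !normal_pdfE// /normal_fun.
set q := normal_peak s; set q' := normal_peak (_ * s).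
have q'_neq0 : q' != 0 by rewrite gt_eqF// normal_peak_gt0.
have q_ge0 : 0 <= q by exact: normal_peak_ge0.
rewrite exprMn sqr_sqrtr//.
set u := x - m.
pose v := (u / (2 * s)) ^+ 2.
have v_ge0 : 0 <= v by exact: sqr_ge0.
have -> : - u ^+ 2 / (s ^+ 2 *+ 2) = - v - v.
  by rewrite /v; field.
have -> : - u ^+ 2 / (2 * s ^+ 2 *+ 2) = - v.
  by rewrite /v; field.
(* 1 + v dominates |u / (2 s)| whatever its size, and a single term of the
   exponential series bounds its powers *)
have powk : (1 + v) ^+ k <= k`!%:R * expR (1 + v).
  have v1_ge0 : 0 <= 1 + v by rewrite addr_ge0.
  case: k {K} => [|k]; first by rewrite expr0 fact0 mul1r -[X in X <= _]expR0 ler_expR.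
  have := expR_ge1Dxn k v1_ge0.
  rewrite -ler_pdivrMl ?ltr0n ?fact_gt0// mulrC.
  by apply: le_trans; rewrite lerDr.
have uk : `|u| ^+ k <= K * expR v.
  have -> : `|u| = (2 * s) * `|u / (2 * s)|.
    by rewrite normrM normfV [`|2 * s|]gtr0_norm ?mulr_gt0// mulrCA divff ?mulr1// mulf_neq0.
  rewrite exprMn /K -!mulrA ler_pM2l ?exprn_gt0 ?mulr_gt0//.
  rewrite -expRD; apply: le_trans powk.
  rewrite lerXn2r ?nnegrE ?addr_ge0//.
  have := sqr_ge0 (`|u / (2 * s)| - 1).
  have := normr_ge0 (u / (2 * s)).
  rewrite /v -(real_normK (num_real (u / (2 * s)))).
  nra.
rewrite !normrM normrX (ger0_norm q_ge0) (ger0_norm (expR_ge0 _)).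
have -> : K * (q / q') * (q' * expR (- v)) = (K * expR v) * (q * expR (- v - v)).
  rewrite expRD expRN.
  have ? : expR v != 0 by rewrite gt_eqF// expR_gt0.
  by field; apply/andP.
by rewrite ler_wpM2r// mulr_ge0// expR_ge0.
Qed.

Lemma integrable_exprn_normal_pdf k :
  mu.-integrable setT (fun x => ((x - m) ^+ k * normal_pdf m s x)%:E).
Proof.
have [C Cb] := exprn_normal_pdf_le k.
apply: (@le_integrable _ _ _ mu _ _ _
  (fun x => (C%:E * (normal_pdf m (Num.sqrt 2 * s) x)%:E)%E)) => //.
- apply/measurable_EFinP/measurable_funM; last exact: measurable_normal_pdf.
  by apply: measurable_funX; exact: measurable_funB.
- move=> x _ /=; rewrite lee_fin (le_trans (Cb x))//.
  exact: ler_norm.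
- by apply: integrableZl => //; exact: integrable_normal_pdf.
Qed.

(** The power k + 1 is bounded by a constant, so the power k decays at least
    like 1 / |x - m|. *)
Lemma cvg_exprn_normal_pdf k :
  ((x - m) ^+ k * normal_pdf m s x @[x --> -oo] --> (0 : R)) /\
  ((x - m) ^+ k * normal_pdf m s x @[x --> +oo] --> (0 : R)).
Proof.
have [C Cb] := exprn_normal_pdf_le k.+1.
pose K := `|C| * normal_peak (Num.sqrt 2 * s).
have K_ge0 : 0 <= K by rewrite mulr_ge0// normal_peak_ge0.
have bnd x : x != m -> `|(x - m) ^+ k * normal_pdf m s x| <= K / `|x - m|.
  move=> xm.
  rewrite ler_pdivlMr ?normr_gt0 ?subr_eq0// -normrM mulrAC -exprSr.
  apply: (le_trans (Cb x)).
  apply: (@le_trans _ _ (`|C| * normal_pdf m (Num.sqrt 2 * s) x)).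
    by rewrite ler_wpM2r ?normal_pdf_ge0// ler_norm.
  by rewrite ler_wpM2l// normal_pdf_ub// mulf_neq0// gt_eqF// sqrtr_gt0.
have far e x : 0 < e -> (K / e + 1 < `|x - m|) ->
    `|(x - m) ^+ k * normal_pdf m s x| < e.
  move=> e0 h.
  have Ke : 0 <= K / e by rewrite divr_ge0// ltW.
  have xm : 0 < `|x - m| by rewrite (le_lt_trans _ h)// addr_ge0.
  apply: (le_lt_trans (bnd x _)); first by rewrite -subr_eq0 -normr_gt0.
  rewrite ltr_pdivrMr// mulrC -ltr_pdivrMr//.
  by rewrite (lt_trans _ h)// ltrDl.
split; apply/cvgr0Pnorm_lt => e e0; near=> x; apply: far => //.
  rewrite -normrN opprB (lt_le_trans _ (ler_norm _))// ltrBrDr -ltrBrDl.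
  near: x; apply: nbhs_ninfty_lt; exact: num_real.
rewrite (lt_le_trans _ (ler_norm _))// ltrBrDr.
near: x; apply: nbhs_pinfty_gt; exact: num_real.
Unshelve. all: by end_near. Qed.

Let is_derive_center (x : R) : is_derive x 1 (fun y : R => y - m) 1.
Proof.
apply: (@is_derive_eq _ _ _ _ _ _ _ _ (is_deriveB (is_derive_id x 1) (is_derive_cst m x 1))).
by rewrite subr0.
Qed.

Lemma is_derive_normal_pdf (x : R) :
  is_derive x 1 (normal_pdf m s) (- (x - m) / s ^+ 2 * normal_pdf m s x).
Proof.
rewrite normal_pdfE// /normal_fun.
pose g (y : R) : R := - (s ^+ 2 *+ 2)^-1 * (y - m) ^+ 2.
have dg : is_derive x 1 g (- (x - m) / s ^+ 2).
  apply: (@is_derive_eq _ _ _ _ _ _ _ _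
    (is_deriveZ (- (s ^+ 2 *+ 2)^-1) (is_deriveX 2 (is_derive_center x)))).
  by rewrite /GRing.scale/=; field.
have -> : (fun y => normal_peak s * expR (- (y - m) ^+ 2 / (s ^+ 2 *+ 2))) =
    (fun y => normal_peak s * (expR \o g) y).
  by apply/funext => y /=; congr (_ * expR _); rewrite /g mulNr mulrC mulNr.
apply: (@is_derive_eq _ _ _ _ _ _ _ _ (is_deriveZ (normal_peak s)
   (is_derive1_comp (is_derive_expR (g x)) dg))).
rewrite /GRing.scale /=.
rewrite (_ : g x = - (x - m) ^+ 2 / (s ^+ 2 *+ 2)) /g ?mulNr//; first by ring.
by rewrite mulrC.
Qed.

(** Integration by parts: the derivative of (x - m)^(k+1) f is
    (k+1) (x - m)^k f - s^-2 (x - m)^(k+2) f, and it integrates to zero. *)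
Lemma Rintegral_exprn_normal_pdfS k :
  \int[mu]_x ((x - m) ^+ k.+2 * normal_pdf m s x) =
  k.+1%:R * s ^+ 2 * \int[mu]_x ((x - m) ^+ k * normal_pdf m s x).
Proof.
pose F x := (x - m) ^+ k.+1 * normal_pdf m s x.
pose f x := k.+1%:R * ((x - m) ^+ k * normal_pdf m s x)
  - s ^- 2 * ((x - m) ^+ k.+2 * normal_pdf m s x).
have FE : F = (fun y : R => y - m) ^+ k.+1 * normal_pdf m s.
  by apply/funext => x; rewrite /F [RHS]/GRing.mul/= exprfctE.
have dF (x : R) : is_derive x 1 F (f x).
  rewrite FE; apply: (@is_derive_eq _ _ _ _ _ _ _ _ (is_deriveM
    (is_deriveX k.+1 (is_derive_center x)) (is_derive_normal_pdf x))).
  rewrite /f /GRing.scale/= exprfctE !exprS.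
  by field.
have cpow j : continuous (fun x : R => (x - m) ^+ j).
  move=> x; apply: (@continuous_comp _ _ _ (fun x : R => x - m) (fun y => y ^+ j)).
    by apply: cvgB; [exact: cvg_id|exact: cvg_cst].
  exact: exprn_continuous.
have cpdf : continuous (normal_pdf m s) by exact: continuous_normal_pdf.
have cf : continuous f.
  move=> x; apply: cvgB; apply: cvgM; (try exact: cvg_cst);
    apply: cvgM; [exact: cpow|exact: cpdf|exact: cpow|exact: cpdf].
have int0 := integrable_exprn_normal_pdf k.
have int2 := integrable_exprn_normal_pdf k.+2.
have int0' : mu.-integrable setT
    (EFin \o (fun x => k.+1%:R * ((x - m) ^+ k * normal_pdf m s x))).
  exact: (integrableZl measurableT k.+1%:R int0).
have int2' : mu.-integrable setT
    (EFin \o (fun x => s ^- 2 * ((x - m) ^+ k.+2 * normal_pdf m s x))).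
  exact: (integrableZl measurableT (s ^- 2) int2).
have intf : mu.-integrable setT (EFin \o f).
  exact: (integrableB measurableT int0' int2').
have [FNy Fy] := cvg_exprn_normal_pdf k.+1.
have := Rintegral_derive1T F f 0 0 dF cf intf FNy Fy.
rewrite RintegralB// !RintegralZl// subr0 => /eqP; rewrite subr_eq0 => /eqP h.
by rewrite -mulrA mulrCA h mulrA divff ?mul1r// expf_neq0.
Qed.

(** The derivative of the density f is - s^-2 (x - m) f. *)
Lemma Rintegral_center_normal_pdf :
  \int[mu]_x ((x - m) * normal_pdf m s x) = 0.
Proof.
have dF (x : R) : is_derive x 1 (normal_pdf m s)
    (- s ^- 2 * ((x - m) ^+ 1 * normal_pdf m s x)).
  apply: (@is_derive_eq _ _ _ _ _ _ _ _ (is_derive_normal_pdf x)).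
  by rewrite expr1; ring.
have cpdf : continuous (normal_pdf m s) by exact: continuous_normal_pdf.
have int1 := integrable_exprn_normal_pdf 1.
have [FNy Fy] := cvg_exprn_normal_pdf 0.
have := Rintegral_derive1T (normal_pdf m s) _ 0 0 dF.
rewrite RintegralZl// subrr => h.
suff /eqP : - s ^- 2 * \int[mu]_x ((x - m) ^+ 1 * normal_pdf m s x) = 0.
  by rewrite mulf_eq0 oppr_eq0 invr_eq0 expf_eq0/= (negbTE s_neq0) => /eqP.
apply: h.
- move=> x; apply: cvgM; first exact: cvg_cst.
  apply: cvgM; last exact: cpdf.
  by apply: cvgB; [exact: cvg_id|exact: cvg_cst].
- exact: (integrableZl measurableT (- s ^- 2) int1).
- by under eq_fun do rewrite -[normal_pdf m s _]mul1r.
- by under eq_fun do rewrite -[normal_pdf m s _]mul1r.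
Qed.

End normal_moments.

Section normal_integrals.
Context {R : realType} (m s : R).
Hypothesis s_gt0 : 0 < s.
Notation mu := lebesgue_measure.

Lemma Rintegral_quartic_normal_pdf (c0 c1 c2 c3 c4 : R) :
  \int[mu]_x (normal_pdf m s x * (c0 + c1 * (x - m) + c2 * (x - m) ^+ 2
                                  + c3 * (x - m) ^+ 3 + c4 * (x - m) ^+ 4)) =
  c0 + c2 * s ^+ 2 + 3 * c4 * s ^+ 4.
Proof.
pose P k x := (x - m) ^+ k * normal_pdf m s x.
have intP k : mu.-integrable setT (EFin \o P k) by exact: integrable_exprn_normal_pdf.
have intcP c k : mu.-integrable setT (EFin \o (fun x => c * P k x)).
  exact: (integrableZl measurableT c (intP k)).
have M0 : \int[mu]_x P 0%N x = 1.
  have := integral_normal_pdf m s.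
  rewrite /Rintegral /P; under [in X in _ -> X = _]eq_integral do rewrite expr0 mul1r.
  by move=> ->.
have M1 : \int[mu]_x P 1%N x = 0.
  rewrite -[RHS](Rintegral_center_normal_pdf m s s_gt0).
  by apply: eq_Rintegral => x _; rewrite /P expr1.
have MS k : \int[mu]_x P k.+2 x = k.+1%:R * s ^+ 2 * \int[mu]_x P k x.
  exact: Rintegral_exprn_normal_pdfS.
transitivity (\int[mu]_x (((c0 * P 0%N x + c1 * P 1%N x) + c2 * P 2%N x + c3 * P 3%N x) + c4 * P 4%N x)).
  by apply: eq_Rintegral => x _; rewrite /P; ring.
have int1 := integrableD measurableT (intcP c0 0%N) (intcP c1 1%N).
have int2 := integrableD measurableT int1 (intcP c2 2%N).
have int3 := integrableD measurableT int2 (intcP c3 3%N).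
have Z c k : \int[mu]_x (c * P k x) = c * \int[mu]_x P k x by exact: RintegralZl.
rewrite !RintegralD// !Z (MS 2%N) (MS 1%N) (MS 0%N) M0 M1.
by ring.
Qed.

(** Raising to the power b + 1 multiplies the Gaussian exponent by b + 1, that
    is, divides the variance by b + 1; the remaining constant comes from the
    change of normalization. *)
Lemma powR_normal_pdf (b x : R) : 0 < b + 1 ->
  normal_pdf m s x `^ (b + 1) =
  normal_peak s `^ b / Num.sqrt (b + 1) * normal_pdf m (s / Num.sqrt (b + 1)) x.
Proof.
move=> b1.
have s_neq0 : s != 0 by rewrite gt_eqF.
have sb_gt0 : 0 < Num.sqrt (b + 1) by rewrite sqrtr_gt0.
have sb_neq0 : Num.sqrt (b + 1) != 0 by rewrite gt_eqF.
have peak_gt0 : 0 < normal_peak s by exact: normal_peak_gt0.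
rewrite !normal_pdfE ?mulf_neq0 ?invr_neq0//.
rewrite powRM ?expR_ge0 ?(ltW peak_gt0)// powRD; last by rewrite (gt_eqF b1).
rewrite powRr1 ?(ltW peak_gt0)//.
have -> : normal_peak (s / Num.sqrt (b + 1)) = Num.sqrt (b + 1) * normal_peak s.
  rewrite /normal_peak expr_div_n sqr_sqrtr ?(ltW b1)//.
  rewrite (_ : s ^+ 2 / (b + 1) * pi *+ 2 = (s ^+ 2 * pi *+ 2) / (b + 1)); last by ring.
  by rewrite sqrtrM ?sqrtrV ?invfM ?invrK ?(ltW b1)// 1?mulrC// pmulrn_lge0// mulr_ge0// ?sqr_ge0// pi_ge0.
have -> : normal_fun m s x `^ (b + 1) = normal_fun m (s / Num.sqrt (b + 1)) x.
  rewrite /normal_fun -expRM expr_div_n sqr_sqrtr ?(ltW b1)//; congr expR.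
  by field; rewrite s_neq0 gt_eqF.
by field.
Qed.

End normal_integrals.

(** * The score at the null hypothesis *)

(** Reduces a partial derivative in the parameter space to a derivative in one
    real variable. *)
Lemma derive_line {R : numFieldType} {V W : normedModType R} (f : V -> W) (a v : V) :
  'D_v f a = 'D_1 (fun t : R => f (t *: v + a)) 0.
Proof.
rewrite /derive.
suff -> : (fun t : R => t^-1 *: ((f \o shift a) (t *: v) - f a)) =
    (fun t : R => t^-1 *: (((fun t : R => f (t *: v + a)) \o shift 0) (t *: 1)
       - f (0 *: v + a))) by [].
by apply/funext => t /=; rewrite addr0 scale0r add0r /GRing.scale/= mulr1.
Qed.

Lemma ln_normal_pdf {R : realType} (m v y : R) : 0 < v ->
  ln (normal_pdf m (Num.sqrt v) y) =
  - (2^-1 * ln (2 * pi * v)) - (y - m) ^+ 2 / (2 * v).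
Proof.
move=> v0.
have sv0 : 0 < Num.sqrt v by rewrite sqrtr_gt0.
have c_gt0 : 0 < 2 * pi * v by rewrite !mulr_gt0// pi_gt0.
rewrite normal_pdfE ?gt_eqF// /normal_fun [in LHS]lnM ?posrE ?expR_gt0 ?normal_peak_gt0 ?gt_eqF//.
rewrite expRK sqr_sqrtr ?ltW//; congr (_ + _); last by rewrite mulNr -mulr_natl.
rewrite /normal_peak sqr_sqrtr ?ltW// (_ : v * pi *+ 2 = 2 * pi * v); last by ring.
rewrite lnV ?posrE ?sqrtr_gt0//.
by rewrite -powR12_sqrt ?ltW// ln_powR.
Qed.

(** Mean and variance both move along the curve, the mean affinely; the two
    summands are the contributions of the variance and of the mean. *)
Lemma derive_ln_normal_pdf {R : realType} (m0 dm y v0 dv : R) (v : R -> R) :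
  v 0 = v0 -> 0 < v0 -> is_derive (0 : R) 1 v dv ->
  'D_1 (fun t : R => ln (normal_pdf (t * dm + m0) (Num.sqrt (v t)) y)) 0 =
  dv / v0 * (((y - m0) ^+ 2 / v0 - 1) / 2) + dm * ((y - m0) / v0).
Proof.
move=> vv0 v0_gt0 dvP.
have v0_neq0 : v0 != 0 by rewrite gt_eqF.
pose G : R -> R := fun t =>
   - (2^-1 * (@ln R \o (fun t => 2 * pi * v t)) t) - (y - (t * dm + m0)) ^+ 2 * (2 * v t)^-1.
(* the closed form of the log-density is valid only where the variance v t is
   positive, i.e. near 0, which suffices for the derivative at 0 *)
have vpos : \forall t \near 0, 0 < v t.
  have cv : {for 0, continuous v}.
    by apply: differentiable_continuous; apply/derivable1_diffP.
  by apply: (cvgr_gt _ cv); rewrite vv0.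
have GE : \forall t \near 0,
    G t = ln (normal_pdf (t * dm + m0) (Num.sqrt (v t)) y).
  near=> t; rewrite ln_normal_pdf//; near: t; exact: vpos.
apply: derive_val; apply: (near_eq_is_derive GE).
have dln : is_derive (2 * pi * v 0) 1 (@ln R) (2 * pi * v 0)^-1.
  by apply: is_derive1_ln; rewrite vv0 !mulr_gt0// pi_gt0.
have dcv : is_derive (0 : R) 1 (fun t => 2 * pi * v t) (2 * pi * dv).
  exact: (is_deriveZ (2 * pi) dvP).
have d1 := is_derive1_comp (g := fun t => 2 * pi * v t) dln dcv.
have d2 : is_derive (0 : R) 1 (fun t => y - (t * dm + m0)) (- dm).
  apply: (@is_derive_eq _ _ _ _ _ _ _ _ (is_deriveB (is_derive_cst y (0 : R) 1)
    (is_deriveD (is_deriveM (is_derive_id (0 : R) 1) (is_derive_cst dm (0 : R) 1))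
      (is_derive_cst m0 (0 : R) 1)))).
  by rewrite /GRing.scale/=; ring.
have d2v : is_derive (0 : R) 1 (fun t => 2 * v t) (2 * dv).
  exact: (is_deriveZ 2 dvP).
have v2_neq0 : 2 * v 0 != 0 by rewrite vv0 mulf_neq0.
have d3 := is_deriveV (f := fun t => 2 * v t) v2_neq0 d2v.
apply: (@is_derive_eq _ _ _ _ _ _ _ _ (is_deriveB (is_deriveN (is_deriveZ 2^-1 d1))
   (is_deriveM (is_deriveX 2 d2) d3))).
rewrite /GRing.scale/= vv0 mul0r add0r exprfctE.
have pi_neq0 : (pi : R) != 0 by rewrite gt_eqF// pi_gt0.
(* the identity holds for any nonzero constant in place of pi *)
move: (@pi R) pi_neq0 => c c_neq0.
by field; rewrite v0_neq0.
Unshelve. all: by end_near. Qed.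

Section dot_product.
Context {R : realType}.

Lemma dotvE n (u v : 'cV[R]_n) : dotv u v = \sum_i u i ord0 * v i ord0.
Proof. by rewrite /dotv mxE; apply: eq_bigr => i _; rewrite mxE. Qed.

Lemma dotvDZr n (u v v' : 'cV[R]_n) (t : R) :
  dotv u (t *: v + v') = t * dotv u v + dotv u v'.
Proof. by rewrite /dotv mulmxDr -scalemxAr !mxE. Qed.

Lemma dotv0 n (u : 'cV[R]_n) : dotv u 0 = 0.
Proof. by rewrite /dotv mulmx0 mxE. Qed.

Lemma dot0v n (u : 'cV[R]_n) : dotv 0 u = 0.
Proof. by rewrite /dotv trmx0 mul0mx mxE. Qed.

Lemma dotvZl n (u v : 'cV[R]_n) (t : R) : dotv (t *: u) v = t * dotv u v.
Proof. by rewrite /dotv linearZ/= -scalemxAl mxE. Qed.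

Lemma dotv_col_mx n1 n2 (u1 : 'cV[R]_n1) (u2 : 'cV[R]_n2) (v : 'cV[R]_(n1 + n2)) :
  dotv (col_mx u1 u2) v = dotv u1 (usubmx v) + dotv u2 (dsubmx v).
Proof. by rewrite /dotv -{1}[v]vsubmxK tr_col_mx mul_row_col mxE. Qed.

Lemma dotv_delta n (u : 'cV[R]_n) j : dotv u (delta_mx j ord0) = u j ord0.
Proof.
rewrite dotvE (bigD1 j)//= big1 ?addr0 ?mxE ?eqxx ?mulr1//.
by move=> i ij; rewrite mxE (negbTE ij) mulr0.
Qed.

Lemma dotvZr n (u v : 'cV[R]_n) (t : R) : dotv u (t *: v) = t * dotv u v.
Proof. by rewrite -[t *: v]addr0 dotvDZr dotv0 addr0. Qed.

Lemma dotvC n (u v : 'cV[R]_n) : dotv u v = dotv v u.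
Proof. by rewrite !dotvE; apply: eq_bigr => i _; rewrite mulrC. Qed.

End dot_product.

Section null_score.
Context {R : realType} {r p : nat}.
Variables (h : R -> R) (w : nat -> 'cV[R]_p) (z : nat -> 'cV[R]_r).
Hypothesis h_derivable0 : derivable h 0 1.
Hypothesis h_at0 : h 0 = 1.
Variables (v : R) (b : 'cV[R]_(1 + p)).
Hypothesis v_gt0 : 0 < v.

Notation theta0 := (mk_param (0 : 'cV[R]_r) v b).
Notation mean i := (dotv (add_intercept (w i)) b).
Notation mu := lebesgue_measure.

Let v_neq0 : v != 0. Proof. by rewrite gt_eqF. Qed.

(** The gradient at the null point of the logarithm of the variance of Y_i. *)
Definition scale_dir (i : nat) : 'cV[R]_(r + (1 + (1 + p))) :=
  col_mx (derive1 h 0 *: z i) (col_mx v^-1%:M 0).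

(** The gradient of the mean of Y_i. *)
Definition mean_dir (i : nat) : 'cV[R]_(r + (1 + (1 + p))) :=
  col_mx 0 (col_mx 0 (add_intercept (w i))).

Lemma density_null i y :
  density h w z i theta0 y = normal_pdf (mean i) (Num.sqrt v) y.
Proof.
rewrite /density /par_b /par_sigma2 /par_alpha /mk_param.
by rewrite !(col_mxKd, col_mxKu) dotv0 h_at0 mulr1 mxE mulr1n.
Qed.

(** Along a coordinate line through the null point the mean is affine and the
    variance is (v + t d) h(t z_i^T a), where a and d are the alpha and sigma^2
    components of the direction; its logarithmic derivative at t = 0 is
    d / v + h'(0) z_i^T a. *)
Lemma score_null i y :
  score h w z i theta0 y =
    (((y - mean i) ^+ 2 / v - 1) / 2) *: scale_dir i
    + ((y - mean i) / v) *: mean_dir i.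
Proof.
apply/matrixP => j k; rewrite (ord1 k) {k} [LHS]mxE derive_line [RHS]mxE [X in _ = X + _]mxE [X in _ = _ + X]mxE.
set d := delta_mx j ord0.
pose za := dotv (z i) (par_alpha d).
pose xb := dotv (add_intercept (w i)) (par_b d).
pose vt t := (t * par_sigma2 d + v) * h (t * za).
have vt0 : vt 0 = v by rewrite /vt !mul0r add0r h_at0 mulr1.
have dh : is_derive ((fun t : R => t * za) 0) 1 h (derive1 h 0).
  by rewrite mul0r derive1E; exact: derivableP.
have dline (x y' : R) : is_derive (0 : R) 1 (fun t => t * x + y') x.
  apply: (@is_derive_eq _ _ _ _ _ _ _ _ (is_deriveD
    (is_deriveM (is_derive_id (0 : R) 1) (is_derive_cst x (0 : R) 1))
    (is_derive_cst y' (0 : R) 1))).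
  by rewrite /GRing.scale/=; ring.
have dz : is_derive (0 : R) 1 (fun t => t * za) za.
  by have := dline za 0; under eq_fun do rewrite addr0.
have dvt : is_derive (0 : R) 1 vt (par_sigma2 d + v * (derive1 h 0 * za)).
  have := is_deriveM (dline (par_sigma2 d) v) (is_derive1_comp (g := fun t => t * za) dh dz).
  move/is_derive_eq; apply.
  by rewrite /GRing.scale/= !mul0r h_at0 add0r mul1r addrC.
under eq_fun => t.
  rewrite /density.
  rewrite (_ : dotv _ _ = t * xb + mean i); last first.
    by rewrite -dotvDZr /par_b /mk_param !(linearD, linearZ)/= !col_mxKd.
  rewrite (_ : par_sigma2 _ * _ = vt t); last first.
    rewrite /vt /za /par_sigma2 /par_alpha /mk_param !(linearD, linearZ)/=.
    by rewrite !(col_mxKd, col_mxKu) addr0 !mxE mulr1n -[LHS]/(_ * h (dotv (z i) _)) -[_ *: _]addr0 dotvDZr dotv0 addr0.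
  over.
rewrite (derive_ln_normal_pdf _ _ _ _ _ _ vt0 v_gt0 dvt).
have -> : scale_dir i j ord0 = derive1 h 0 * za + par_sigma2 d / v.
  rewrite -dotv_delta /scale_dir !dotv_col_mx dotvZl dot0v addr0; congr (_ + _).
  by rewrite dotvE big_ord1 mxE mulr1n mulrC.
have -> : mean_dir i j ord0 = xb.
  by rewrite -dotv_delta /mean_dir 2!dotv_col_mx !dot0v !add0r.
by field.
Qed.

Let score_null_coef i y j :
  score h w z i theta0 y j ord0 =
    ((y - mean i) ^+ 2 / v - 1) / 2 * scale_dir i j ord0
    + (y - mean i) / v * mean_dir i j ord0.
Proof.
by rewrite score_null [LHS]mxE [X in X + _]mxE [X in _ + X]mxE.
Qed.

(** * Information matrices at the null hypothesis *)

(** The total mass of the density raised to the power beta + 1. *)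
Definition pdf_power_scale (beta : R) : R :=
  normal_peak (Num.sqrt v) `^ beta / Num.sqrt (beta + 1).

(** The expectation of ((u^2/v - 1)/2)^2 for u centred Gaussian of variance
    v/(beta + 1), times the mass; [J_mean] and [xi_scale] are likewise
    those of (u/v)^2 and of (u^2/v - 1)/2. *)
Definition J_scale (beta : R) : R :=
  pdf_power_scale beta * ((beta ^+ 2 + 2) / (4 * (beta + 1) ^+ 2)).

Definition J_mean (beta : R) : R := pdf_power_scale beta / ((beta + 1) * v).

Definition xi_scale (beta : R) : R :=
  - (pdf_power_scale beta * (beta / (2 * (beta + 1)))).

Lemma Rintegral_density_quartic i (beta c0 c1 c2 c3 c4 : R) (f : R -> R) :
  0 < beta + 1 ->
  (forall y, f y = c0 + c1 * (y - mean i) + c2 * (y - mean i) ^+ 2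
     + c3 * (y - mean i) ^+ 3 + c4 * (y - mean i) ^+ 4) ->
  \int[mu]_y (density h w z i theta0 y `^ (beta + 1) * f y) =
  pdf_power_scale beta *
    (c0 + c2 * (v / (beta + 1)) + 3 * c4 * (v / (beta + 1)) ^+ 2).
Proof.
move=> b1 fE.
have sv_gt0 : 0 < Num.sqrt v by rewrite sqrtr_gt0.
have tau_gt0 : 0 < Num.sqrt v / Num.sqrt (beta + 1).
  by rewrite divr_gt0// sqrtr_gt0.
pose K := pdf_power_scale beta.
transitivity (\int[mu]_y (normal_pdf (mean i) (Num.sqrt v / Num.sqrt (beta + 1)) y *
   (K * c0 + K * c1 * (y - mean i) + K * c2 * (y - mean i) ^+ 2
     + K * c3 * (y - mean i) ^+ 3 + K * c4 * (y - mean i) ^+ 4))).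
  apply: eq_Rintegral => y _; rewrite density_null powR_normal_pdf// fE.
  by rewrite -/(pdf_power_scale beta) -/K; ring.
rewrite Rintegral_quartic_normal_pdf//.
rewrite (_ : 4%N = (2 * 2)%N)// exprM expr_div_n !sqr_sqrtr ?(ltW v_gt0) ?(ltW b1)//.
by rewrite /K; ring.
Qed.

(** The cross terms of scale_dir_i and mean_dir_i carry odd powers of the
    residual, so they integrate to zero. *)
Lemma J_i_null i (beta : R) : 0 < beta + 1 ->
  J_i h w z i beta theta0 =
    J_scale beta *: (scale_dir i *m (scale_dir i)^T)
    + J_mean beta *: (mean_dir i *m (mean_dir i)^T).
Proof.
move=> b1; have b1_neq0 : beta + 1 != 0 by rewrite gt_eqF.
apply/matrixP => j k; rewrite [LHS]mxE.
have outer (a c : 'cV[R]_(r + (1 + (1 + p)))) :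
    (a *m c^T) j k = a j ord0 * c k ord0.
  by rewrite mxE big_ord1 [c^T _ _]mxE.
rewrite [RHS]mxE [X in _ = X + _]mxE [X in _ = _ + X]mxE !outer.
set gj := scale_dir i j ord0; set gk := scale_dir i k ord0.
set ej := mean_dir i j ord0; set ek := mean_dir i k ord0.
rewrite (Rintegral_density_quartic i beta (gj * gk / 4)
  (- (gj * ek + ej * gk) / (2 * v))
  (- (gj * gk) / (2 * v) + ej * ek / v ^+ 2)
  ((gj * ek + ej * gk) / (2 * v ^+ 2)) (gj * gk / (4 * v ^+ 2)))//; last first.
  by move=> y; rewrite outer !score_null_coef -/gj -/gk -/ej -/ek; field.
rewrite /J_scale /J_mean.
by field; rewrite v_neq0 b1_neq0.
Qed.

Lemma xi_i_null i (beta : R) : 0 < beta + 1 ->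
  xi_i h w z i beta theta0 = xi_scale beta *: scale_dir i.
Proof.
move=> b1; have b1_neq0 : beta + 1 != 0 by rewrite gt_eqF.
apply/matrixP => j k; rewrite (ord1 k) {k} [LHS]mxE [RHS]mxE.
set gj := scale_dir i j ord0; set ej := mean_dir i j ord0.
rewrite (Rintegral_density_quartic i beta (- gj / 2) (ej / v) (gj / (2 * v)) 0 0)//; last first.
  by move=> y; rewrite score_null_coef -/gj -/ej; field.
rewrite /xi_scale.
by field; rewrite v_neq0 b1_neq0.
Qed.

Lemma K_i_null i (beta : R) : 0 <= beta ->
  K_i h w z i beta theta0 =
    (J_scale (2 * beta) - xi_scale beta ^+ 2)
      *: (scale_dir i *m (scale_dir i)^T)
    + J_mean (2 * beta) *: (mean_dir i *m (mean_dir i)^T).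
Proof.
move=> b0.
rewrite /K_i J_i_null ?xi_i_null ?ltr_wpDl ?mulr_ge0//.
rewrite linearZ/= -scalemxAl -scalemxAr scalerA -expr2 scalerBl.
by rewrite addrAC.
Qed.

Lemma pdf_power_scale_gt0 (beta : R) : 0 <= beta -> 0 < pdf_power_scale beta.
Proof.
move=> b0; rewrite divr_gt0 ?sqrtr_gt0 ?ltr_wpDl// powR_gt0// normal_peak_gt0//.
by rewrite gt_eqF// sqrtr_gt0.
Qed.

Lemma J_scale_gt0 (beta : R) : 0 <= beta -> 0 < J_scale beta.
Proof.
move=> b0; rewrite mulr_gt0 ?pdf_power_scale_gt0 ?divr_gt0 ?mulr_gt0 ?exprn_gt0//.
all: by rewrite ?ltr_wpDl ?sqr_ge0.
Qed.

Lemma J_mean_gt0 (beta : R) : 0 <= beta -> 0 < J_mean beta.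
Proof.
by move=> b0; rewrite divr_gt0 ?pdf_power_scale_gt0 ?mulr_gt0// ltr_wpDl.
Qed.

End null_score.

(** * Positive definite matrices *)

Section posdef.
Context {R : realType}.

Definition posdef {n} (S : 'M[R]_n) :=
  S^T = S /\ forall x : 'cV[R]_n, x != 0 -> 0 < dotv x (S *m x).

(** If x^T S x = 0 then x minimizes the form, so its gradient 2 S x vanishes,
    and S being invertible x = 0. *)
Lemma psd_unit_posdef {n} (S : 'M[R]_n) : S^T = S ->
  (forall x : 'cV[R]_n, 0 <= dotv x (S *m x)) -> S \in unitmx -> posdef S.
Proof.
move=> symS psdS unitS; split => // x x_neq0.
rewrite lt_neqAle psdS andbT eq_sym; apply: contra x_neq0 => /eqP q0.
suff Sx0 : S *m x = 0 by rewrite -[x](mulKmx unitS) Sx0 mulmx0.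
apply/matrixP => j k; rewrite (ord1 k) {k} [RHS]mxE.
set y : 'cV[R]_n := delta_mx j ord0.
set c := dotv y (S *m y).
have -> : (S *m x) j ord0 = dotv y (S *m x).
  by rewrite dotvC dotv_delta.
set e := dotv y (S *m x).
apply/eqP/negPn/negP => e_neq0.
(* along the line t x + y the form is the affine function 2 t e + c, which takes
   the value -1 at this t *)
pose t := - (c + 1) / (2 * e).
have := psdS (t *: x + y).
have -> : dotv (t *: x + y) (S *m (t *: x + y)) = t ^+ 2 * dotv x (S *m x) + 2 * t * e + c.
  have Sxy : dotv y (S *m x) = dotv x (S *m y).
    by rewrite dotvC /dotv trmx_mul symS mulmxA.
  rewrite linearD linearZ/= dotvDZr !(dotvC _ (t *: x + y)) !dotvDZr.
  by rewrite !(dotvC _ (S *m _)) /c /e -Sxy; ring.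
by rewrite q0 mulr0 add0r; rewrite (_ : 2 * t * e = - (c + 1)) /t; [lra|field].
Qed.

Lemma posdef_unit {n} (S : 'M[R]_n) : posdef S -> S \in unitmx.
Proof.
move=> [symS posS]; rewrite -row_free_unit; apply: inj_row_free => u uS0.
apply/eqP/negPn/negP => u_neq0.
have uT_neq0 : u^T != 0 by rewrite -trmx0 (inj_eq trmx_inj).
have Su0 : S *m u^T = 0 by rewrite -symS -trmx_mul uS0 trmx0.
by have := posS _ uT_neq0; rewrite Su0 dotv0 ltxx.
Qed.

Lemma posdef_invmx {n} (S : 'M[R]_n) : posdef S -> posdef (invmx S).
Proof.
move=> pS; have uS := posdef_unit _ pS; case: pS => symS posS.
have symI : (invmx S)^T = invmx S by rewrite trmx_inv symS.
split => // x x_neq0.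
rewrite -{1}[x](mulKVmx uS) /dotv trmx_mul symS -mulmxA.
have y_neq0 : invmx S *m x != 0.
  by apply: contra x_neq0 => /eqP h; rewrite -[x](mulKVmx uS) h mulmx0.
have := posS _ y_neq0.
by rewrite /dotv.
Qed.

Lemma posdef_compress {n k} (S : 'M[R]_n) (M : 'M[R]_(n, k)) :
  M^T *m M = 1%:M -> posdef S -> posdef (M^T *m S *m M).
Proof.
move=> MM [symS posS]; split; first by rewrite !trmx_mul trmxK symS mulmxA.
move=> x x_neq0.
have y_neq0 : M *m x != 0.
  apply: contra x_neq0 => /eqP h.
  by rewrite -[x]mul1mx -MM -mulmxA h mulmx0.
have := posS _ y_neq0.
by rewrite /dotv trmx_mul !mulmxA.
Qed.

End posdef.

(** * Limits of the averaged matrices *)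

(** The source is finite-dimensional: expand in the canonical basis. *)
Lemma linear_mx_continuous {K : numFieldType} m n {V : normedModType K}
  (f : {linear 'M[K]_(m, n) -> V}) : continuous f.
Proof.
have -> : f = (fun Y : 'M[K]_(m, n) =>
    \sum_i \sum_j Y i j *: f (delta_mx i j)) :> ('M[K]_(m, n) -> V).
  apply/funext => Y.
  rewrite {1}[Y]matrix_sum_delta linear_sum; apply: eq_bigr => i _.
  by rewrite linear_sum; apply: eq_bigr => j _; rewrite linearZ.
apply: continuous_big => [|i _]; first exact: add_continuous.
apply: continuous_big => [|j _]; first exact: add_continuous.
move=> X; apply: (@continuous_comp _ _ _ (fun Y : 'M[K]_(m, n) => Y i j) (fun s : K => s *: f (delta_mx i j))).
  exact: coord_continuous.
exact: scalel_continuous.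
Qed.

Section weight_mx.
Context {R : realType} {r p : nat}.

(** The scalar s acts on the coordinates (alpha, sigma^2), the scalar t on the
    regression coefficients: exactly the two supports of [scale_dir] and
    [mean_dir], which are thus eigenvectors. *)
Definition weight_mx (s t : R) : 'M[R]_(r + (1 + (1 + p))) :=
  block_mx s%:M 0 0 (block_mx s%:M 0 0 t%:M).

Lemma weight_mxM s t s' t' :
  weight_mx s t *m weight_mx s' t' = weight_mx (s * s') (t * t').
Proof.
rewrite /weight_mx mulmx_block !(mulmx0, mul0mx, addr0, add0r).
by rewrite mulmx_block !(mulmx0, mul0mx, addr0, add0r) -!scalar_mxM.
Qed.

Lemma weight_mx1 : weight_mx 1 1 = 1%:M.
Proof. by rewrite /weight_mx -!scalar_mx_block. Qed.

Lemma weight_mx_scale_dir (h : R -> R) (z : nat -> 'cV[R]_r) (v : R) i s t :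
  weight_mx s t *m scale_dir h z v i = s *: scale_dir h z v i.
Proof.
rewrite /weight_mx /scale_dir !mul_block_col !(mulmx0, mul0mx, addr0, add0r).
by rewrite !mul_scalar_mx !scale_col_mx scaler0.
Qed.

Lemma weight_mx_mean_dir (w : nat -> 'cV[R]_p) i s t :
  weight_mx s t *m mean_dir w i = t *: mean_dir w i.
Proof.
rewrite /weight_mx /mean_dir !mul_block_col !(mulmx0, mul0mx, addr0, add0r).
by rewrite mul_scalar_mx !scale_col_mx !scaler0.
Qed.

Lemma weight_mx_M s t : weight_mx s t *m M_mx = s *: M_mx.
Proof.
rewrite /weight_mx /M_mx tr_row_mx trmx1 trmx0 mul_block_col.
by rewrite !(mulmx0, mul0mx, addr0) mul_scalar_mx scale_col_mx scaler0.
Qed.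

Lemma trM_weight_mx s t : M_mx^T *m weight_mx s t = s *: M_mx^T.
Proof.
rewrite /weight_mx /M_mx trmxK mul_row_block.
by rewrite !(mulmx0, mul0mx, addr0) mul_mx_scalar scale_row_mx scaler0.
Qed.

Lemma trM_M : (M_mx^T : 'M[R]_(r, r + (1 + (1 + p)))) *m M_mx = 1%:M.
Proof. by rewrite /M_mx trmxK tr_row_mx trmx1 trmx0 mul_row_col mulmx0 addr0 mulmx1. Qed.

End weight_mx.

Section null_limits.
Context {R : realType} {r p : nat}.
Variables (h : R -> R) (w : nat -> 'cV[R]_p) (z : nat -> 'cV[R]_r).
Hypothesis h_derivable0 : derivable h 0 1.
Hypothesis h_at0 : h 0 = 1.
Variables (v : R) (b : 'cV[R]_(1 + p)).
Hypothesis v_gt0 : 0 < v.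

Notation theta0 := (mk_param (0 : 'cV[R]_r) v b).

Definition K_scale (beta : R) : R :=
  J_scale v (2 * beta) - xi_scale v beta ^+ 2.

Definition J_weight (beta : R) : 'M[R]_(r + (1 + (1 + p))) :=
  weight_mx (J_scale v beta / J_scale v 0) (J_mean v beta / J_mean v 0).

Definition K_weight (beta : R) : 'M[R]_(r + (1 + (1 + p))) :=
  weight_mx (K_scale beta / J_scale v 0) (J_mean v (2 * beta) / J_mean v 0).

Let weight_J0 i s t :
  weight_mx (s / J_scale v 0) (t / J_mean v 0) *m J_i h w z i 0 theta0 =
  s *: (scale_dir h z v i *m (scale_dir h z v i)^T)
  + t *: (mean_dir w i *m (mean_dir w i)^T).
Proof.
rewrite (J_i_null h w z) // mulmxDr -!scalemxAr !mulmxA.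
rewrite weight_mx_scale_dir weight_mx_mean_dir -!scalemxAl !scalerA.
have JS : J_scale v 0 != 0 by rewrite gt_eqF// J_scale_gt0.
have JM : J_mean v 0 != 0 by rewrite gt_eqF// J_mean_gt0.
by rewrite mulrC (divfK JS) [J_mean v 0 * _]mulrC (divfK JM).
Qed.

(** The weights do not depend on i, so they factor out of the average. *)
Lemma J_avg_weight beta n : 0 <= beta ->
  J_avg h w z beta theta0 n = J_weight beta *m J_avg h w z 0 theta0 n.
Proof.
move=> b0; rewrite /J_avg -scalemxAr mulmx_sumr; congr (_ *: _).
by apply: eq_bigr => i _; rewrite weight_J0 J_i_null// ltr_wpDl.
Qed.

Lemma K_avg_weight beta n : 0 <= beta ->
  K_avg h w z beta theta0 n = K_weight beta *m J_avg h w z 0 theta0 n.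
Proof.
move=> b0; rewrite /K_avg /J_avg -scalemxAr mulmx_sumr; congr (_ *: _).
by apply: eq_bigr => i _; rewrite weight_J0 K_i_null.
Qed.

Hypothesis J_avg0_cvg : cvg (J_avg h w z 0 theta0 @ \oo).
Notation J0 := (J_mx h w z 0 theta0).

(** Every limit below is the image of the single limit defining J_0 under a
    linear map: left multiplication, transposition or a quadratic form. *)
Lemma lim_linear_J_avg0 {V : normedModType R} (f : {linear _ -> V}) :
  f (J_avg h w z 0 theta0 n) @[n --> \oo] --> f J0.
Proof.
apply: (cvg_comp _ _ J_avg0_cvg).
exact: linear_mx_continuous.
Qed.

Lemma J_mx_weight beta : 0 <= beta ->
  J_mx h w z beta theta0 = J_weight beta *m J0.
Proof.
move=> b0; apply: cvg_lim => //.
rewrite (_ : J_avg _ _ _ beta _ = fun n => J_weight beta *m J_avg h w z 0 theta0 n).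
  exact: (lim_linear_J_avg0 (mulmx (J_weight beta))).
by apply/funext => n; exact: J_avg_weight.
Qed.

Lemma K_mx_weight beta : 0 <= beta ->
  K_mx h w z beta theta0 = K_weight beta *m J0.
Proof.
move=> b0; apply: cvg_lim => //.
rewrite (_ : K_avg _ _ _ beta _ = fun n => K_weight beta *m J_avg h w z 0 theta0 n).
  exact: (lim_linear_J_avg0 (mulmx (K_weight beta))).
by apply/funext => n; exact: K_avg_weight.
Qed.

Let J_avg0E n : J_avg h w z 0 theta0 n = n%:R^-1 *: \sum_(1 <= i < n.+1)
  (J_scale v 0 *: (scale_dir h z v i *m (scale_dir h z v i)^T)
   + J_mean v 0 *: (mean_dir w i *m (mean_dir w i)^T)).
Proof.
by rewrite /J_avg; congr (_ *: _); apply: eq_bigr => i _; rewrite J_i_null.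
Qed.

Let J_avg0_sym n : (J_avg h w z 0 theta0 n)^T = J_avg h w z 0 theta0 n.
Proof.
rewrite J_avg0E linearZ/= linear_sum; congr (_ *: _); apply: eq_bigr => i _.
by rewrite linearD/= !linearZ/= !trmx_mul !trmxK.
Qed.

Let J_avg0_ge0 n x : 0 <= dotv x (J_avg h w z 0 theta0 n *m x).
Proof.
rewrite J_avg0E -scalemxAl mulmx_suml dotvZr.
rewrite mulr_ge0 ?invr_ge0//.
have dsq (u : 'cV[R]_(r + (1 + (1 + p)))) : dotv x (u *m u^T *m x) = dotv u x ^+ 2.
  rewrite -mulmxA [u^T *m x]mx11_scalar -/(dotv u x) mul_mx_scalar.
  by rewrite dotvZr dotvC.
rewrite /dotv mulmx_sumr summxE sumr_ge0// => i _.
rewrite -/(dotv x _) mulmxDl -!scalemxAl dotvDZr dotvZr.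
by rewrite !dsq addr_ge0// mulr_ge0 ?sqr_ge0// ltW ?J_scale_gt0 ?J_mean_gt0.
Qed.

(** Each average is a nonnegative combination of matrices u u^T, hence symmetric
    and positive semidefinite, and both properties pass to the limit. *)
Lemma J_mx0_posdef : J0 \in unitmx -> posdef J0.
Proof.
apply: psd_unit_posdef => [|x].
  have trE : (fun n => (J_avg h w z 0 theta0 n)^T) = J_avg h w z 0 theta0.
    by apply/funext => n; exact: J_avg0_sym.
  have c : (J_avg h w z 0 theta0 n)^T @[n --> \oo] --> J0^T.
    exact: (lim_linear_J_avg0 trmx).
  by rewrite trE in c; exact: (cvg_unique _ c J_avg0_cvg).
have qE n : dotv x (J_avg h w z 0 theta0 n *m x) =
    (mulmxr x \o mulmx x^T) (J_avg h w z 0 theta0 n) ord0 ord0.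
  by rewrite /dotv /= mulmxA.
have q_cvg : dotv x (J_avg h w z 0 theta0 n *m x) @[n --> \oo] --> dotv x (J0 *m x).
  under eq_cvg do rewrite qE.
  rewrite /dotv mulmxA.
  have c := lim_linear_J_avg0 (mulmxr x \o mulmx x^T).
  exact: (@continuous_cvg _ _ _ _ _ _ (fun X : 'M[R]_(1, 1) => X ord0 ord0) _
    (@coord_continuous R 1 1 ord0 ord0 _) c).
by apply: (cvgr_to_ge q_cvg); apply: nearW => n; exact: J_avg0_ge0.
Qed.

End null_limits.

(** * Noncentrality and relative efficiency *)

(** The middle J cancels against one of the outer inverses, which leaves a
    single inverse of J, to the left of all the weights. *)
Lemma sandwich_mulmx {F : fieldType} {n} (J W W' K : 'M[F]_n) :
  J \in unitmx -> W' *m W = 1%:M ->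
  invmx (W *m J) *m (K *m J) *m invmx (W *m J) = invmx J *m (W' *m K *m W').
Proof.
move=> unitJ W'W.
have left_inv : invmx J *m W' *m (W *m J) = 1%:M.
  by rewrite mulmxA -[_ *m W' *m _]mulmxA W'W mulmx1 mulVmx.
have [_ unitWJ] := mulmx1_unit left_inv.
have -> : invmx (W *m J) = invmx J *m W'.
  by rewrite -[LHS]mul1mx -left_inv mulmxK.
by rewrite !mulmxA mulmxK.
Qed.

Section noncentrality.
Context {R : realType} {r p : nat}.
Variables (h : R -> R) (w : nat -> 'cV[R]_p) (z : nat -> 'cV[R]_r).
Hypothesis h_derivable0 : derivable h 0 1.
Hypothesis h_at0 : h 0 = 1.
Variables (v : R) (b : 'cV[R]_(1 + p)).
Hypothesis v_gt0 : 0 < v.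

Notation theta0 := (mk_param (0 : 'cV[R]_r) v b).
Notation J0 := (J_mx h w z 0 theta0).

Hypothesis J_avg0_cvg : cvg (J_avg h w z 0 theta0 @ \oo).
Hypothesis J0_unit : J0 \in unitmx.

(** The factor by which passing from 0 to beta inflates the asymptotic
    covariance matrix of the estimator of alpha. *)
Definition variance_factor (beta : R) : R :=
  K_scale v beta * J_scale v 0 / J_scale v beta ^+ 2.

(** M is an eigenvector of every block weighting, so only the scalars of the
    (alpha, sigma^2) block remain. *)
Lemma V_mx_M beta : 0 <= beta ->
  V_mx h w z beta theta0 *m M_mx =
  variance_factor beta *: (invmx J0 *m M_mx).
Proof.
move=> b0.
have JS0 : J_scale v 0 != 0 by rewrite gt_eqF ?J_scale_gt0.
have JSb : J_scale v beta != 0 by rewrite gt_eqF ?J_scale_gt0.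
have JM0 : J_mean v 0 != 0 by rewrite gt_eqF ?J_mean_gt0.
have JMb : J_mean v beta != 0 by rewrite gt_eqF ?J_mean_gt0.
pose W' : 'M[R]_(r + (1 + (1 + p))) :=
  weight_mx (J_scale v 0 / J_scale v beta) (J_mean v 0 / J_mean v beta).
have W'W : W' *m J_weight v beta = 1%:M.
  rewrite weight_mxM -weight_mx1; congr weight_mx; field; exact/andP.
rewrite /V_mx J_mx_weight// K_mx_weight// (sandwich_mulmx _ _ _ _ J0_unit W'W).
rewrite !weight_mxM -mulmxA weight_mx_M -scalemxAr; congr (_ *: _).
by rewrite /variance_factor; field; apply/andP.
Qed.

Lemma noncentrality_null beta delta : 0 <= beta ->
  variance_factor beta != 0 ->
  noncentrality h w z beta theta0 delta =
  (variance_factor beta)^-1 *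
    dotv delta (invmx (M_mx^T *m invmx J0 *m M_mx) *m delta).
Proof.
move=> b0 vf_neq0.
rewrite /noncentrality -(mulmxA M_mx^T (V_mx _ _ _ _ _)) V_mx_M// -scalemxAr invmxZ.
  by rewrite -scalemxAr -scalemxAl mxE /dotv !mulmxA.
rewrite unitmxZ ?unitfE//.
apply: posdef_unit; rewrite mulmxA.
apply: posdef_compress; first exact: trM_M.
exact/posdef_invmx/J_mx0_posdef.
Qed.

(** Otherwise M^T K_beta = 0, which an invertible K_beta excludes since M^T has
    the right inverse M and the alpha block is nontrivial. *)
Lemma variance_factor_neq0 beta (delta : 'cV[R]_r) : 0 <= beta -> delta != 0 ->
  K_mx h w z beta theta0 \in unitmx -> variance_factor beta != 0.
Proof.
move=> b0 delta_neq0 unitK; apply: contra delta_neq0 => /eqP vf0.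
have K0 : K_scale v beta / J_scale v 0 = 0.
  have JS0 : J_scale v 0 != 0 by rewrite gt_eqF ?J_scale_gt0.
  have JSb : J_scale v beta != 0 by rewrite gt_eqF ?J_scale_gt0.
  transitivity (variance_factor beta * (J_scale v beta / J_scale v 0) ^+ 2).
    by rewrite /variance_factor; field; apply/andP.
  by rewrite vf0 mul0r.
have MTK : M_mx^T *m K_mx h w z beta theta0 = 0.
  by rewrite K_mx_weight// mulmxA trM_weight_mx K0 scale0r mul0mx.
have MT0 : M_mx^T = 0 :> 'M[R]_(r, r + (1 + (1 + p))).
  by rewrite -[M_mx^T](mulmxK unitK) MTK mul0mx.
by rewrite -[delta]mul1mx -(trM_M (p := p)) MT0 !mul0mx.
Qed.

Lemma pitman_ARE_null beta delta : 0 <= beta -> delta != 0 ->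
  K_mx h w z beta theta0 \in unitmx ->
  pitman_ARE h w z beta theta0 delta = variance_factor beta.
Proof.
move=> b0 delta_neq0 unitK.
have vf_neq0 := variance_factor_neq0 _ _ b0 delta_neq0 unitK.
have vf0 : variance_factor 0 = 1.
  rewrite /variance_factor /K_scale /xi_scale mulr0 mul0r mulr0 oppr0 expr0n/= subr0.
  by rewrite -expr2 divff// expf_neq0// gt_eqF ?J_scale_gt0.
have pos : posdef (invmx (M_mx^T *m invmx J0 *m M_mx)).
  apply/posdef_invmx/posdef_compress; first exact: trM_M.
  exact/posdef_invmx/J_mx0_posdef.
have q_neq0 : dotv delta (invmx (M_mx^T *m invmx J0 *m M_mx) *m delta) != 0.
  by rewrite gt_eqF//; apply: pos.2.
rewrite /pitman_ARE !noncentrality_null ?vf0 ?oner_eq0//.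
by rewrite invr1 mul1r invfM invrK mulrCA divff ?mulr1.
Qed.

End noncentrality.

(** Numerator and denominator of the factor are homogeneous of degree two in
    the peak of the density to the power beta, the only place where v occurs,
    so v cancels. *)
Lemma variance_factorE {R : realType} (v beta : R) : 0 < v -> 0 <= beta ->
  variance_factor v beta =
    8 * (beta + 1) ^+ 5 / (beta ^+ 2 + 2) ^+ 2 *
    ((2 * beta ^+ 2 + 1) / (2 * (2 * beta + 1) `^ (5 / 2))
     - beta ^+ 2 / (4 * (beta + 1) ^+ 3)).
Proof.
move=> v_gt0 b0.
have b1 : 0 < beta + 1 by rewrite ltr_wpDl.
have b2 : 0 < 2 * beta + 1 by rewrite ltr_wpDl// mulr_ge0.
have bb : 0 < beta ^+ 2 + 2 by rewrite ltr_wpDl ?sqr_ge0.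
have p_gt0 : 0 < normal_peak (Num.sqrt v).
  by rewrite normal_peak_gt0// gt_eqF// sqrtr_gt0.
have a_gt0 := powR_gt0 beta p_gt0.
have -> : (2 * beta + 1) `^ (5 / 2) = (2 * beta + 1) ^+ 2 * Num.sqrt (2 * beta + 1).
  rewrite (_ : 5 / 2 = 2%:R + 2^-1); last by field.
  rewrite powRD; last by rewrite (gt_eqF b2) implybT.
  by rewrite powR_mulrn ?ltW// powR12_sqrt// ltW.
rewrite /variance_factor /K_scale /J_scale /xi_scale /pdf_power_scale.
rewrite powRr0 add0r sqrtr1 [2 * beta]mulrC powRrM powR_mulrn ?(ltW a_gt0)// [beta * 2]mulrC.
set a := normal_peak _ `^ beta.
set s1 := Num.sqrt (beta + 1); set s2 := Num.sqrt (2 * beta + 1).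
have s1E : beta + 1 = s1 ^+ 2 by rewrite sqr_sqrtr ?ltW.
have s1_neq0 : s1 != 0 by rewrite gt_eqF// sqrtr_gt0.
have s2_neq0 : s2 != 0 by rewrite gt_eqF// sqrtr_gt0.
have a_neq0 : a != 0 by rewrite gt_eqF.
have b1_neq0 : beta + 1 != 0 by rewrite gt_eqF.
have b2_neq0 : 2 * beta + 1 != 0 by rewrite gt_eqF.
have bb_neq0 : beta ^+ 2 + 2 != 0 by rewrite gt_eqF.
rewrite sqrrN ![(_ / s1 * _) ^+ 2]exprMn !expr_div_n -s1E.
by field; apply/and5P.
Qed.

Theorem theorem9 (R : realType) (r p : nat)
  (h : R -> R) (w : nat -> 'cV[R]_p) (z : nat -> 'cV[R]_r)
  (h_continuous : continuous h)
  (h_derivable : forall t : R, derivable h t 1)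
  (h_derivable2 : forall t : R, derivable (derive1 h) t 1)
  (h_gt0 : forall t : R, 0 < h t)
  (h_at0 : h 0 = 1)
  (dh_at0 : derive1 h 0 != 0)
  (beta : R) (beta_gt0 : 0 < beta)
  (sigma2_0 : R) (sigma2_0_gt0 : 0 < sigma2_0) (b_0 : 'cV[R]_(1 + p))
  (regular_classical : regular_at h w z 0 (mk_param 0 sigma2_0 b_0))
  (regular_beta : regular_at h w z beta (mk_param 0 sigma2_0 b_0))
  (delta : 'cV[R]_r) (delta_neq0 : delta != 0) :
  pitman_ARE h w z beta (mk_param 0 sigma2_0 b_0) delta =
    8 * (beta + 1) ^+ 5 / (beta ^+ 2 + 2) ^+ 2 *
    ((2 * beta ^+ 2 + 1) / (2 * (2 * beta + 1) `^ (5 / 2))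
     - beta ^+ 2 / (4 * (beta + 1) ^+ 3)).
Proof.
case: regular_classical => J_cvg _ J_unit _.
case: regular_beta => _ _ _ K_unit.
rewrite pitman_ARE_null ?(ltW beta_gt0)//.
by rewrite variance_factorE// ltW.
Qed.
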